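(* Let $G$ be a non-periodic group, let $\mathbb{K}$ be a field, and let $V$ be an infinite-dimensional vector space over $\mathbb{K}$. Then there exists a linear cellular automaton $\tau' \colon V^G \to V^G$ such that $\tau'(V^G)$ is not closed in $V^G$ with respect to the prodiscrete topology.
   Context: A group is periodic if all its elements have finite order; it is non-periodic otherwise. For a group $G$ and a set $A$, $A^G$ denotes the set of all maps $x \colon G \to A$, with left $G$-action (the shift) given by $(gx)(h) = x(g^{-1}h)$ for $g,h \in G$, $x \in A^G$. A cellular automaton over the group $G$ and the alphabet $A$ is a map $\tau \colon A^G \to A^G$ for which there exist a finite subset $M \subset G$ and a map $\mu \colon A^M \to A$ such that $\tau(x)(g) = \mu(\pi_M(g^{-1}x))$ for all $x \in A^G$ and $g \in G$, where $\pi_M \colon A^G \to A^M$ is the restriction map. When $V$ is a vector space over a field $\mathbb{K}$, a cellular automaton $\tau \colon V^G \to V^G$ is linear if it is $\mathbb{K}$-linear with respect to the natural (pointwise) $\mathbb{K}$-vector space structure on $V^G$. The prodiscrete topology on $A^G$ is the product topology obtained by taking the discrete topology on each factor $A$ of $A^G$. *)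

(* Defs.v *)
From HB Require Import structures.
From mathcomp Require Import all_boot all_order all_algebra.
From mathcomp Require Import all_classical topology.

Set Implicit Arguments.
Unset Strict Implicit.
Unset Printing Implicit Defensive.

Import GRing.Theory.
Local Open Scope classical_set_scope.
Local Open Scope ring_scope.

Definition periodic (G : groupType) : Prop :=
  forall g : G, exists2 n : nat, (0 < n)%N & (g ^+ n = 1)%g.

Definition finite_dimensional (K : fieldType) (V : lmodType K) : Prop :=
  exists (n : nat) (e : 'I_n -> V),
    forall v : V, exists c : 'I_n -> K, v = \sum_(i < n) c i *: e i.

Definition shift (G : groupType) (A : Type) (g : G) (x : G -> A) : G -> A :=
  fun h => x (g^-1 * h)%g.

(* [sigL M] is the restriction map A^G -> A^M. *)
Definition cellular_automaton (G : groupType) (A : Type)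
    (tau : (G -> A) -> (G -> A)) : Prop :=
  exists (M : set G) (mu : (M -> A) -> A), finite_set M /\
    forall (x : G -> A) (g : G), tau x g = mu (sigL M (shift g^-1 x)).

(* The scaling on [G -> V] is the pointwise one. *)
Definition linear_cellular_automaton (G : groupType) (K : fieldType)
    (V : lmodType K) (tau : (G -> V) -> (G -> V)) : Prop :=
  cellular_automaton tau /\ linear tau.

(* The type A^G, carrying the prodiscrete topology. *)
Definition prodiscrete (G : Type) (A : choiceType) : topologicalType :=
  prod_topology (fun _ : G => discrete_topology A).

(* Main.v *)
Require Import Defs.
From HB Require Import structures.
From mathcomp Require Import all_boot all_order all_algebra.
From mathcomp Require Import all_classical topology.
Local Open Scope classical_set_scope.
Local Open Scope ring_scope.

(** An infinite-dimensional [V] contains a copy of [{poly K}] as a direct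
    summand: [poly_embedding] gives [ev : {poly K} -> V] by picking an infinite
    independent sequence, and [linear_retraction] gives [p : V -> {poly K}] with
    [p \o ev = id] by taking a complement of the image with Zorn's lemma.
    Multiplication by ['X] on this summand, extended by zero on the complement,
    is [phi = ev \o ('X * _) \o p].  Fix [t] in [G] of infinite order and let
    [tau x g = x g - phi (x (g * t))], a linear cellular automaton.

    The constant configuration [y = ev 1] witnesses that the image of [tau] is
    not closed.
    - It has no preimage: if [tau x = y], then along [g = t ^+ m] the
      polynomials [p (x g)] satisfy [p (x g) = 1 + 'X * p (x (g * t))], so every
      coefficient of each of them is 1, as for the power series [1 / (1 - 'X)];
      no polynomial is like that.
    - It is a limit of images: on a finite set [s], take for [x g] the truncation
      of that power series to [n g] terms, where [n g] is the number of steps the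
      path [g, g * t, g * t ^+ 2, ...] makes before it first leaves [s].  This
      number is finite since [t] has infinite order ([orbit_leaves]), and
      drops by one along each step that starts in [s], which is what
      [tau x g = y g] requires.  By [nbhs_prodiscrete] agreement on finite sets
      is enough. *)

Set Implicit Arguments.
Unset Strict Implicit.
Unset Printing Implicit Defensive.

Import GRing.Theory.

(** The sets of configurations agreeing with [y] on a finite set generate a
    filter that converges to [y] coordinatewise, hence in the product
    topology. *)
Lemma nbhs_prodiscrete (G A : choiceType) (y : prodiscrete G A)
    (B : set (prodiscrete G A)) :
  nbhs y B ->
  exists s : seq G,
    forall z : G -> A, (forall g, g \in s -> z g = y g) -> B z.
Proof.
pose agree (s : seq G) : set (prodiscrete G A) :=
  [set z | forall g, g \in s -> z g = y g].
pose F := filter_from [set: seq G] agree.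
have FF : Filter F.
  apply: filter_fromT_filter; first by exists [::].
  move=> s s'; exists (s ++ s') => z zy.
  by split=> g gs; apply: zy; rewrite mem_cat gs ?orbT.
suff Fy : F --> y by move=> /Fy [s _ sB]; exists s => z zs; apply: sB => g /zs.
apply/cvg_sup => g U.
rewrite (@nbhsE (initial_topology (@^~ g))) => -[O [[C _ <-] Cy] CU].
exists [:: g] => // z zy; apply: CU => /=.
by rewrite /proj zy ?mem_head.
Qed.

Lemma cellular_automaton2 (G : groupType) (A : Type) (t : G)
    (nu : A -> A -> A) :
  cellular_automaton (fun x g => nu (x g) (x (g * t)%g)).
Proof.
pose M : set G := [set 1%g; t].
have M1 : 1%g \in M by rewrite inE; left.
have Mt : t \in M by rewrite inE; right.
exists M, (fun p => nu (p (exist _ 1%g M1)) (p (exist _ t Mt))).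
split; first exact: finite_set2.
by move=> x g; rewrite /sigL /shift /= invgK mulg1.
Qed.

(** A subspace [U] maximal among those meeting the image of [f] trivially is a
    complement of that image, and [p] is the projection along [U] followed by
    the inverse of [f]. *)
Lemma linear_retraction (K : fieldType) (W V : lmodType K)
    (f : {linear W -> V}) :
  injective f -> exists p : {linear V -> W}, cancel f p.
Proof.
move=> f_inj.
(* The empty set satisfies [P] as well, so that Zorn's lemma also applies to
   the empty chain; a maximal [U] is nonempty, hence contains 0. *)
pose P (U : set V) :=
  (forall a u v, U u -> U v -> U (a *: u + v)) /\
  (forall w, U (f w) -> w = 0).
have [U [[Ulin Uf] Umax]] : exists U, P U /\ forall B, U `<` B -> ~ P B.
  apply: Zorn_bigcup => C CP Ctot; split=> [a u v [X CX Xu] [Y CY Yv]|w].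
    have [XY|YX] := Ctot _ _ CX CY.
      by exists Y => //; apply: (CP _ CY).1 => //; apply: XY.
    by exists X => //; apply: (CP _ CX).1 => //; apply: YX.
  by move=> [X /CP[_]]; apply.
have U0 : U 0.
  have [U00|[u Uu]] : U = set0 \/ exists u, U u.
  - by have [->|/set0P[u Uu]] := eqVneq U set0; [left|right; exists u].
  - exfalso; apply: (Umax [set 0]).
      by rewrite U00; split=> // /(_ 0 erefl).
    split=> [a _ _ -> ->|w fw0]; first by rewrite scaler0 addr0.
    by apply: f_inj; rewrite fw0 linear0.
  - by rewrite -(addNr u) -scaleN1r; apply: Ulin.
have UD u v : U u -> U v -> U (u + v).
  by move=> Uu Uv; rewrite -[u]scale1r; apply: Ulin.
have UZ a u : U u -> U (a *: u).
  by move=> Uu; rewrite -[_ *: _]addr0; apply: Ulin.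
have Ufull v : exists w, U (v - f w).
  apply: contrapT => /forallNP Uv.
  (* Otherwise [v] lies outside [U] + im [f], and [U] can be enlarged to
     [U] + [K v]. *)
  pose B : set V := [set x | exists c u, U u /\ x = c *: v + u].
  apply: (Umax B).
    split=> [u Uu|BU]; first by exists 0, u; rewrite scale0r add0r.
    apply: (Uv 0); rewrite linear0 subr0; apply: BU.
    by exists 1, 0; rewrite scale1r addr0.
  split=> [a _ _ [c [u [Uu ->]]] [d [u' [Uu' ->]]]|w [c [u [Uu fw]]]].
    exists (a * c + d), (a *: u + u'); split; first exact: Ulin.
    by rewrite scalerDr scalerDl scalerA addrACA.
  have [c0|c0] := eqVneq c 0.
    by apply: Uf; rewrite fw c0 scale0r add0r.
  case: (Uv (c^-1 *: w)).
  rewrite linearZ fw /= scalerDr scalerA mulVf // scale1r opprD addNKr.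
  by rewrite -scaleNr; apply: UZ.
have [p Up] := choice Ufull.
have pP v w : U (v - f w) -> p v = w.
  move=> Uw; apply/eqP; rewrite -subr_eq0; apply/eqP/Uf.
  rewrite linearB /=.
  have -> : f (p v) - f w = v - f w + (-1) *: (v - f (p v)).
    by rewrite scaleN1r opprB [RHS]addrC addrA subrK.
  by apply: UD => //; apply: UZ.
have p_lin : linear p.
  move=> a u v; apply: pP; rewrite linearP.
  have := Ulin a _ _ (Up u) (Up v); congr U.
  by rewrite scalerBr addrACA opprD.
pose q : {linear V -> W} := HB.pack p (GRing.isLinear.Build _ _ _ _ p p_lin).
exists q => w; apply: pP; by rewrite subrr.
Qed.

(** Since finitely many vectors never span [V], a sequence [e] can be built in
    which each term avoids the span of the preceding ones; the polynomial with
    coefficients [c i] goes to the combination of the [e i] with these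
    coefficients.  A nonzero polynomial in the kernel would express the [e i]
    of its leading term through the earlier ones. *)
Lemma poly_embedding (K : fieldType) (V : lmodType K) :
  ~ finite_dimensional V -> exists f : {linear {poly K} -> V}, injective f.
Proof.
move=> Vinf.
have next (s : seq V) : exists v,
    forall c : nat -> K, v <> \sum_(i < size s) c i *: s`_i.
  apply: contrapT => /forallNP sV; apply: Vinf.
  exists (size s), (fun i => s`_i) => v.
  have /existsNP[c /contrapT ->] := sV v.
  by exists (fun i => c i).
have [nx nxP] := choice next.
pose e n := nx (iter n (fun s => rcons s (nx s)) [::]).
have iterE n : iter n (fun s => rcons s (nx s)) [::] = mkseq e n.
  by elim: n => //= n IH; rewrite mkseqS -IH.
have eP n (c : nat -> K) : e n <> \sum_(i < n) c i *: e i.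
  move=> en; apply: (nxP (mkseq e n) c); rewrite -iterE -/(e n) en iterE.
  by rewrite size_mkseq; apply: eq_bigr => i _; rewrite nth_mkseq.
pose f (p : {poly K}) := \sum_(i < size p) p`_i *: e i.
(* A common number of terms for all the polynomials involved makes the
   linearity of [f] a termwise computation. *)
have fE n (p : {poly K}) : (size p <= n)%N -> f p = \sum_(i < n) p`_i *: e i.
  move=> pn; rewrite /f (big_ord_widen n (fun i => p`_i *: e i)) //.
  rewrite big_mkcond; apply: eq_bigr => i _; case: ltnP => // /(nth_default 0) ->.
  by rewrite scale0r.
have f_lin : linear f.
  move=> a p q; set n := maxn (size (a *: p + q)) (maxn (size p) (size q)).
  rewrite !(fE n) ?leq_max ?leqnn ?orbT // scaler_sumr -big_split.
  by apply: eq_bigr => i _; rewrite coefD coefZ scalerDl scalerA.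
pose F : {linear {poly K} -> V} :=
  HB.pack f (GRing.isLinear.Build _ _ _ _ f f_lin).
exists F; apply: raddf_inj => p Fp; apply/eqP; apply: contrapT => /negP p0.
have sp : size p = (size p).-1.+1 by rewrite prednK // size_poly_gt0.
have lc0 : lead_coef p != 0 by rewrite lead_coef_eq0.
apply: (eP (size p).-1 (fun i => - (lead_coef p)^-1 * p`_i)).
move: Fp; rewrite /= /f sp big_ord_recr /= -/(lead_coef p) => /eqP.
rewrite addrC addr_eq0 => /eqP /(congr1 (fun v => (lead_coef p)^-1 *: v)).
rewrite scalerA mulVf // scale1r scalerN -scaleNr scaler_sumr => ->.
by apply: eq_bigr => i _; rewrite scalerA.
Qed.

(** The points [g * t ^+ n] are pairwise distinct, so they cannot all fit in a
    finite set. *)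
Lemma orbit_leaves (G : groupType) (t : G) :
  (forall n, (0 < n)%N -> (t ^+ n)%g <> 1%g) ->
  forall (s : seq G) (g : G), exists n, (g * t ^+ n)%g \notin s.
Proof.
move=> t_inf s g; apply: contrapT => /forallNP stay.
have t_inj : injective (fun n => g * t ^+ n)%g.
  have wl m n : (m <= n)%N -> (g * t ^+ m = g * t ^+ n)%g -> m = n.
    move=> mn /mulgI; rewrite -(subnK mn) expgnDr => /esym/eqP.
    rewrite -{2}[(t ^+ m)%g]mul1g => /eqP/mulIg tn.
    by case: (posnP (n - m)) => [->|/t_inf].
  by move=> m n mn; have [/wl|/ltnW/wl] := leqP m n; [|symmetry]; auto.
have: (size (mkseq (fun n => g * t ^+ n)%g (size s).+1) <= size s)%N.
  apply: uniq_leq_size; first exact: mkseq_uniq.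
  by move=> _ /mapP[n _ ->]; apply/negPn/negP/stay.
by rewrite size_mkseq ltnn.
Qed.

Theorem theorem1p5 (G : groupType) (K : fieldType) (V : lmodType K)
    (Gnonper : ~ periodic G) (Vinf : ~ finite_dimensional V) :
  exists tau' : (G -> V) -> (G -> V),
    linear_cellular_automaton tau' /\
    ~ @closed (prodiscrete G V) (range tau').
Proof.
have [t t_inf] : exists t : G, forall n, (0 < n)%N -> (t ^+ n)%g <> 1%g.
  move/existsNP: Gnonper => [t t_inf]; exists t => n n0 tn.
  by apply: t_inf; exists n.
have [ev /linear_retraction[p evK]] := poly_embedding Vinf.
pose phi v := ev ('X * p v).
pose tau (x : G -> V) := fun g => x g - phi (x (g * t)%g).
exists tau; split.
  split; first exact: (cellular_automaton2 t (fun a b => a - phi b)).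
  move=> a x y; apply/funext => g; rewrite /tau /phi /=.
  rewrite fctE linearP mulrDr linearD -scalerAr linearZ /=.
  by rewrite scalerBr opprD addrACA.
pose y : prodiscrete G V := fun=> ev 1.
move=> /(_ y) tau_closed.
have [|x _ xy] := tau_closed.
  move=> B /nbhs_prodiscrete[s sB].
  pose n g := ex_minn (orbit_leaves t_inf s g).
  have n_step g : g \in s -> n g = (n (g * t)%g).+1.
    move=> gs; apply/eqP; rewrite eqn_leq; apply/andP; split.
      rewrite {1}/n; case: ex_minnP => a ga; apply.
      rewrite /n; case: ex_minnP => b; rewrite expgS mulgA => gb _.
      exact: gb.
    rewrite /n; case: ex_minnP => b gb min_b; case: ex_minnP => -[|a].
      by rewrite expg0 mulg1 gs.
    by rewrite expgS mulgA => ga _; apply: min_b.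
  (* [q k] is the sum of ['X^i] for [i < k]. *)
  pose q k := iter k (fun r : {poly K} => 1 + 'X * r) 0.
  pose x g := ev (q (n g)).
  exists (tau x); split; first by exists x.
  apply: sB => g gs; rewrite /tau /x /phi evK n_step //=.
  by rewrite linearD addrK.
have coefs k m : (p (x (t ^+ m)%g))`_k = 1.
  have step j : p (x (t ^+ j)%g) = 1 + 'X * p (x (t ^+ j.+1)%g).
    have := congr1 (@^~ (t ^+ j)%g) xy; rewrite /tau -expgSr.
    move=> /eqP; rewrite subr_eq => /eqP->.
    by rewrite /y /phi -linearD evK.
  (* Degree [k.+1] at [m] reduces to degree [k] at [m.+1]. *)
  elim: k m => [|k IH] m; rewrite step coefD coefXM coef1 /= ?addr0 //.
  by rewrite IH add0r.
have := coefs (size (p (x 1%g))) 0; rewrite nth_default // => /esym/eqP.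
by rewrite oner_eq0.
Qed.
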